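(* A finite graph has cutwidth at most $2$ if and only if it is (isomorphic to) a subgraph of some chain of cycles.
   Context: All graphs are finite and simple. A graph with $n$ vertices has cutwidth at most $2$ if its vertices can be numbered $1,\ldots,n$ (bijectively) so that for every $i=1,\ldots,n-1$ there are at most two edges $(u,v)$ with $u\le i<v$. A chain of $n$ cycles is a union of $n$ cycles $Z_1,\ldots,Z_n$ together with vertices $a_j,b_j\in Z_j$ ($j=1,\ldots,n$) such that $Z_i\cap Z_j=\emptyset$ whenever $|i-j|>1$, and $Z_{j-1}\cap Z_j=\{b_{j-1}\}=\{a_j\}$ for every $j=2,\ldots,n$. A chain of cycles is a chain of $n$ cycles for some $n\ge 1$. *)

(* Defs.v *)
From mathcomp Require Import all_boot.
Set Implicit Arguments. Unset Strict Implicit. Unset Printing Implicit Defensive.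

(* A finite simple graph: T : finType with a symmetric irreflexive e : rel T. *)

(* Cutwidth at most 2: a bijective numbering (0-based: vertex x gets number
   ord x + 1) such that for every i = 1..n-1 at most two edges (u,v) satisfy
   num u <= i < num v, i.e. ord u < i <= ord v. *)
Definition cutwidth_le2 (T : finType) (e : rel T) : Prop :=
  exists ord : T -> 'I_#|T|, injective ord /\
    forall i : nat, 1 <= i -> i < #|T| ->
      #|[set p : T * T | e p.1 p.2 && ((ord p.1 < i) && (i <= ord p.2))]| <= 2.

Definition cycle_edge (T : eqType) (Z : seq T) (x y : T) : bool :=
  (x \in Z) && ((next Z x == y) || (next Z y == x)).

Definition chain_of_cycles (T : finType) (e : rel T) : Prop :=
  exists (n : nat) (Z : nat -> seq T) (a b : nat -> T),
    0 < n /\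
        (forall j, j < n ->
           [/\ 3 <= size (Z j), uniq (Z j), a j \in Z j & b j \in Z j]) /\
        (forall x : T, exists j, j < n /\ x \in Z j) /\
        (forall x y : T, (e x y <-> exists j, j < n /\ cycle_edge (Z j) x y)) /\
        (forall i j, i < n -> j < n -> (i.+1 < j \/ j.+1 < i) ->
           forall x, x \in Z i -> x \notin Z j) /\
        (forall j, 0 < j < n ->
           b j.-1 = a j /\
           forall x, ((x \in Z j.-1) && (x \in Z j)) = (x == b j.-1)).

(* Main.v *)
Require Import Defs.
From mathcomp Require Import all_boot zify.
Set Implicit Arguments. Unset Strict Implicit. Unset Printing Implicit Defensive.

(** A chain of cycles has cutwidth at most 2: list the cycles one after the
    other, and inside a cycle with attachment vertices [a] and [b] list one arc
    from [a] to [b] first, then the other arc in the same direction, [b] last.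

    Conversely, sweep the vertices in the given order while building a chain.
    The cycle under construction is a path, and the at most two edges across
    the current cut leave from its two ends. A new vertex either prolongs the
    path at one end, or closes the cycle (through a filler vertex if an end is
    free) and starts the next one, or is isolated, in which case it is put into
    the last cycle at the end. *)

(** * Rankings by natural numbers, with gaps allowed, and cutwidth *)

Definition cut_set (T : finType) (e : rel T) (r : T -> nat) (t : nat) :=
  [set p : T * T | e p.1 p.2 && ((r p.1 < t) && (t <= r p.2))].

(** Compress the ranks: [x] is numbered by how many vertices rank below it. The order is kept, so
    the cut at position [i] is the cut at the rank of the vertex numbered [i]. *)
Lemma cutwidth_le2_of_rank (T : finType) (e : rel T) (r : T -> nat) :
  injective r -> (forall t, #|cut_set e r t| <= 2) -> cutwidth_le2 e.
Proof.
move=> r_inj cut_le.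
have lt_card x : #|[set y | r y < r x]| < #|T|.
  rewrite -cardsT; apply: proper_card; apply/properP; split; first exact: subsetT.
  by exists x; rewrite // inE ltnn.
pose o x : 'I_#|T| := Ordinal (lt_card x).
have o_mono x y : r x < r y -> o x < o y.
  move=> lt_xy; apply: proper_card; apply/properP; split.
    by apply/subsetP => z; rewrite !inE => /ltn_trans; apply.
  by exists x; rewrite !inE ?ltnn.
have o_lt x y : (o x < o y) = (r x < r y).
  apply/idP/idP; last exact: o_mono.
  case: (ltngtP (r x) (r y)) => // [/o_mono|/r_inj->]; last by rewrite ltnn.
  by move=> /ltnW; rewrite leqNgt => /negbTE->.
have o_inj : injective o.
  move=> x y eq_o; apply: r_inj; apply/eqP; have := o_lt x y; have := o_lt y x.
  by rewrite eq_o ltnn; lia.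
exists o; split=> // i _ lt_i.
have [g _ og] := inj_card_bij o_inj (eq_leq (card_ord _)).
rewrite (_ : [set p | _] = cut_set e r (r (g (Ordinal lt_i)))) //.
apply/setP=> p; rewrite !inE; congr (_ && (_ && _)).
  by rewrite -o_lt og.
by rewrite leqNgt [RHS]leqNgt -o_lt og.
Qed.

Lemma cutwidth_le2_embed (T T' : finType) (e : rel T) (e' : rel T')
    (f : T -> T') (r : T' -> nat) :
  injective f -> (forall x y, e x y -> e' (f x) (f y)) ->
  injective r -> (forall t, #|cut_set e' r t| <= 2) -> cutwidth_le2 e.
Proof.
move=> f_inj f_hom r_inj cut_le.
apply: (@cutwidth_le2_of_rank _ _ (r \o f)); first exact: inj_comp.
move=> t; apply: leq_trans (cut_le t).
pose g (p : T * T) := (f p.1, f p.2).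
have g_inj : injective g by move=> [x y] [x' y'] [/f_inj-> /f_inj->].
rewrite -(card_imset _ g_inj); apply/subset_leq_card/subsetP => _ /imsetP[p + ->].
by rewrite !inE /= => /andP[/f_hom-> ->].
Qed.

(** * Edges of a single cycle and a ranking of its vertices *)

Lemma index_next (T : eqType) (Z : seq T) x : uniq Z -> x \in Z ->
  index (next Z x) Z = if (index x Z).+1 == size Z then 0 else (index x Z).+1.
Proof.
move=> uZ xZ; rewrite next_nth xZ; case: Z uZ xZ => // y s uZ xZ.
case: eqP => [[eq_i]|ne_i].
  rewrite nth_default; first by rewrite /= eqxx.
  by rewrite -eq_i.
have lt_i : index x (y :: s) < size (y :: s) by rewrite index_mem.
rewrite -[nth y s _]/(nth y (y :: s) (index x (y :: s)).+1) index_uniq //.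
by move: ne_i lt_i => /= ; lia.
Qed.

Lemma cycle_edge_rot (T : eqType) n (Z : seq T) : uniq Z ->
  cycle_edge (rot n Z) =2 cycle_edge Z.
Proof. by move=> uZ x y; rewrite /cycle_edge mem_rot !next_rot. Qed.

(** [next] fixes every vertex outside [Z] and maps [Z] into itself, so no edge leaves [Z]. *)
Lemma cycle_edge_mem (T : eqType) (Z : seq T) x y :
  cycle_edge Z x y -> (x \in Z) && (y \in Z).
Proof.
case/andP=> xZ; rewrite xZ; case: (boolP (y \in Z)) => // yZ.
have -> : next Z y = y by rewrite next_nth (negbTE yZ).
rewrite -(mem_next Z x) in xZ.
case/orP=> /eqP eq_xy; first by rewrite eq_xy (negbTE yZ) in xZ.
by rewrite mem_next -eq_xy (negbTE yZ) in xZ.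
Qed.

Lemma cycle_edge_sym (T : eqType) (Z : seq T) : symmetric (cycle_edge Z).
Proof.
move=> x y; apply/idP/idP => xy; have /andP[xZ yZ] := cycle_edge_mem xy;
  by move: xy; rewrite /cycle_edge xZ yZ orbC.
Qed.

(* Rank the vertices increasingly along one arc from [a] to [b], then
   decreasingly along the other: each arc crosses a threshold at most once. *)
Lemma cycle_rank (T : finType) (Z : seq T) a b :
  uniq Z -> a \in Z -> b \in Z -> a != b ->
  exists r : T -> nat,
    [/\ {in Z &, injective r}, r a = 0, {in Z, forall x, r x <= r b}
      & forall t, #|cut_set (cycle_edge Z) r t| <= 2].
Proof.
move=> uZ aZ bZ neq_ab.
have [k s defZ] := rot_to aZ.
suff [r [r_inj ra rb cutr]] : exists r : T -> nat,
    [/\ {in a :: s &, injective r}, r a = 0, {in a :: s, forall x, r x <= r b}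
      & forall t, #|cut_set (cycle_edge (a :: s)) r t| <= 2].
  exists r; split=> //.
  - by move=> x y xZ yZ; apply: r_inj; rewrite -defZ mem_rot.
  - by move=> x xZ; apply: rb; rewrite -defZ mem_rot.
  - move=> t; apply: leq_trans (cutr t); apply/subset_leq_card/subsetP => p.
    by rewrite !inE -defZ cycle_edge_rot.
have: b \in a :: s by rewrite -defZ mem_rot.
have: uniq (a :: s) by rewrite -defZ rot_uniq.
have ia : index a (a :: s) = 0 by rewrite /= eqxx.
have ib : 0 < index b (a :: s) by rewrite /= (negbTE neq_ab).
move: (a :: s) ia ib => W ia ib uW bW {defZ}.
pose m := index b W; pose N := size W.
have lt_mN : m < N by rewrite index_mem.
(* Positions before [b] keep their index as rank; positions [m] to [N.-1] take the ranks [N.-1] down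
   to [m], so [b] ranks highest. *)
pose h i := if i < m then i else N.-1 + m - i.
have idx_inj : {in W &, injective (index^~ W)}.
  by move=> x y xW yW eq_i; rewrite -(nth_index b xW) eq_i nth_index.
have lt_idx x : x \in W -> index x W < N by rewrite -index_mem.
exists (fun x => h (index x W)); split.
- move=> x y xW yW /= eq_h; apply: idx_inj => //=.
  by move: (lt_idx _ xW) (lt_idx _ yW) eq_h; rewrite /h; do 2!case: ifP; lia.
- by rewrite ia /h ib.
- move=> x /lt_idx; rewrite /h -/m ltnn; case: ifP; lia.
(* Cut edges inject into [bool] by their direction: knowing whether an edge runs along [next], both
   its ends can be computed from [t], as [key] does. *)
move=> t; rewrite -[2]card_bool.
apply: (@leq_card_in _ _ (fun p : T * T => next W p.1 == p.2)).
have key p : p \in cut_set (cycle_edge W) (fun x => h (index x W)) t ->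
    [/\ p.1 \in W, p.2 \in W &
     if next W p.1 == p.2 then
      index p.1 W = (minn t m).-1 /\ index p.2 W = minn t m
    else index p.2 W = minn N.-1 (N.-1 + m - t) /\
      index p.1 W = let j := minn N.-1 (N.-1 + m - t) in
        if j.+1 == N then 0 else j.+1].
  case: p => x y; rewrite inE /= => /andP[xy /andP[lt_t le_t]].
  have /andP[xW yW] := cycle_edge_mem xy; split=> //.
  move: xy lt_t le_t (lt_idx _ xW) (lt_idx _ yW); rewrite /cycle_edge xW /=.
  have := index_next uW xW; have := index_next uW yW; rewrite -/N.
  rewrite /h; case: (next W x =P y) => [->|_] /= => [_ nx _|ny nx /eqP eqy].
    move: nx; set i := index x W; set j := index y W => ->.
    by do ?case: ifP => //; lia.
  move: ny; rewrite eqy; set i := index x W; set j := index y W => ->.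
  by do ?case: ifP => //; lia.
move=> [x y] [x' y'] /key/= [xW yW kxy] /key/= [xW' yW' kxy'] eq_n.
move: kxy kxy'; rewrite eq_n; case: ifP => _ [i1 i2] [i1' i2'].
all: by congr (_, _); apply: idx_inj => //=; rewrite ?i1 ?i2 ?i1' ?i2'.
Qed.

(** * Ranking a whole chain of cycles *)

(** Induction on the number of cycles: the ranks of the new cycle are shifted by [r (b k)], the
    largest rank so far. Thresholds up to [r (b k)] then cut old edges only, and larger ones cut
    edges of the new cycle only. *)
Lemma chain_prefix_rank (T : finType) (n : nat) (Z : nat -> seq T)
    (a b : nat -> T) :
  (forall j, j < n -> [/\ uniq (Z j), a j \in Z j, b j \in Z j & a j != b j]) ->
  (forall i j, i.+1 < j < n -> forall x, x \in Z i -> x \notin Z j) ->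
  (forall j, j.+1 < n ->
     b j = a j.+1 /\ forall x, (x \in Z j) && (x \in Z j.+1) = (x == b j)) ->
  forall k, k < n ->
  exists r : T -> nat,
    [/\ {in [pred x | [exists j : 'I_k.+1, x \in Z j]] &, injective r},
        forall x (j : 'I_k.+1), x \in Z j -> r x <= r (b k)
      & forall t, #|cut_set (fun x y =>
          [exists j : 'I_k.+1, cycle_edge (Z j) x y]) r t| <= 2].
Proof.
move=> Zok Zdisj Zlink; elim=> [|k IHk] lt_kn.
  have [uZ aZ bZ ne_ab] := Zok _ lt_kn.
  have [r [r_inj _ r_max r_cut]] := cycle_rank uZ aZ bZ ne_ab.
  exists r; split.
  - by move=> x y /existsP[j xj] /existsP[j' yj']; apply: r_inj;
      [move: xj; rewrite (ord1 j) | move: yj'; rewrite (ord1 j')].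
  - by move=> x j; rewrite (ord1 j); apply: r_max.
  - move=> t; apply: leq_trans (r_cut t); apply/subset_leq_card/subsetP=> p.
    by rewrite !inE => /andP[/existsP[j]]; rewrite (ord1 j) => -> ->.
have [r [r_inj r_max r_cut]] := IHk (ltnW lt_kn).
have [uZ aZ bZ ne_ab] := Zok _ lt_kn.
have [_ _ bkZ _] := Zok _ (ltnW lt_kn).
have [ba meet] := Zlink _ lt_kn.
have [q [q_inj qa q_max q_cut]] := cycle_rank uZ aZ bZ ne_ab.
pose U x := [exists j : 'I_k.+1, x \in Z j].
have UI x (j : 'I_k.+1) : x \in Z j -> U x by move=> xj; apply/existsP; exists j.
have Ub : U (b k) by apply: (UI _ ord_max).
have UZ x : U x -> x \in Z k.+1 -> x = b k.
  case/existsP=> j xj xZ; have := ltn_ord j; rewrite ltnS leq_eqVlt.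
  case/orP=> [/eqP eq_j|lt_j]; last first.
    by move: xZ; rewrite (negbTE (Zdisj j k.+1 _ x xj)) // ltnS lt_j.
  by apply/eqP; rewrite -meet -eq_j xj eq_j.
(* Both branches agree at the shared vertex, since [q] vanishes at [a k.+1]. *)
pose r' x := if U x then r x else r (b k) + q x.
have r'U x : U x -> r' x = r x by rewrite /r' => ->.
have r'Z x : x \in Z k.+1 -> r' x = r (b k) + q x.
  by rewrite /r'; case: ifP => // Ux xZ; rewrite (UZ x Ux xZ) ba qa addn0.
have splitU x : [exists j : 'I_k.+2, x \in Z j] -> U x \/ x \in Z k.+1.
  case/existsP=> j xj; have := ltn_ord j; rewrite ltnS leq_eqVlt.
  case/orP=> [/eqP <-|lt_j]; first by right.
  by left; apply: (UI x (Ordinal lt_j)).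
have r_maxU x : U x -> r x <= r (b k) by case/existsP=> j; apply: r_max.
have mixed x y : U x -> y \in Z k.+1 -> r' x = r' y -> x = y.
  move=> Ux yZ; rewrite r'U // r'Z // => eq_r.
  have qy : q y = q (a k.+1) by rewrite qa; have := r_maxU x Ux; lia.
  have yb : y = b k by rewrite ba; apply: q_inj.
  by rewrite yb; apply: r_inj => //; rewrite eq_r qy qa addn0.
exists r'; split.
- move=> x y /splitU[Ux|xZ] /splitU[Uy|yZ].
  + by rewrite !r'U //; apply: r_inj.
  + exact: mixed.
  + by move=> eq_r; apply/esym/mixed.
  + by rewrite !r'Z // => /addnI/q_inj->.
- move=> x j xj; rewrite (r'Z (b k.+1)) //.
  have /splitU[Ux|xZ] : [exists j : 'I_k.+2, x \in Z j] by apply/existsP; exists j.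
    by rewrite r'U //; have := r_maxU x Ux; lia.
  by rewrite r'Z // leq_add2l q_max.
move=> t; case: (leqP t (r (b k))) => le_t.
  apply: leq_trans (r_cut t); apply/subset_leq_card/subsetP=> -[x y].
  rewrite !inE /= => /andP[/existsP[j xy] /andP[lt_x le_y]].
  have := ltn_ord j; rewrite ltnS leq_eqVlt.
  case/orP=> [/eqP eq_j|lt_j]; have /andP[xj yj] := cycle_edge_mem xy.
    by move: lt_x; rewrite r'Z; [lia | rewrite -eq_j].
  apply/andP; split; first by apply/existsP; exists (Ordinal lt_j).
  by rewrite -(r'U x) ?(UI x (Ordinal lt_j)) // -(r'U y) ?(UI y (Ordinal lt_j)) // lt_x.
apply: leq_trans (q_cut (t - r (b k))); apply/subset_leq_card/subsetP=> -[x y].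
rewrite !inE /= => /andP[/existsP[j xy] /andP[lt_x le_y]].
have /andP[xj yj] := cycle_edge_mem xy.
have := ltn_ord j; rewrite ltnS leq_eqVlt => /orP[/eqP eq_j|lt_j].
  rewrite eq_j in xy xj yj; rewrite xy /=.
  by move: lt_x le_y; rewrite !r'Z //; lia.
have Uy := UI y (Ordinal lt_j) yj.
by move: le_y; rewrite r'U //; have := r_maxU y Uy; lia.
Qed.

Lemma next_neq (T : eqType) (Z : seq T) x :
  uniq Z -> 1 < size Z -> x \in Z -> x != next Z x.
Proof.
move=> uZ gt1 xZ; apply/eqP => /(congr1 (index^~ Z)).
by rewrite /= index_next //; case: eqP; lia.
Qed.

Lemma chain_rank (T : finType) (e : rel T) : chain_of_cycles e ->
  exists2 r : T -> nat, injective r & forall t, #|cut_set e r t| <= 2.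
Proof.
case=> n [Z [a [b [n0 [Zok [Zcover [eE [Zdisj Zlink]]]]]]]].
(* The free ends of the first and last cycle may coincide with the
   attachment vertices; move them so that both arcs are nonempty. *)
pose a' j := if j == 0 then next (Z 0) (b 0) else a j.
pose b' j := if j.+1 == n then next (Z j) (a' j) else b j.
have a'Z j : j < n -> a' j \in Z j.
  by move=> lt_j; have [_ _ aZ bZ] := Zok j lt_j; rewrite /a'; case: eqP bZ => // ->;
    rewrite mem_next.
have Zlink' j : j.+1 < n ->
     b' j = a' j.+1 /\ forall x, (x \in Z j) && (x \in Z j.+1) = (x == b' j).
  by move=> lt_j; rewrite /b' /a' ltn_eqF //=; apply: (Zlink j.+1).
have Zok' j : j < n -> [/\ uniq (Z j), a' j \in Z j, b' j \in Z j & a' j != b' j].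
  move=> lt_j; have [sZ uZ aZ bZ] := Zok j lt_j; split=> //.
  - exact: a'Z.
  - by rewrite /b'; case: ifP; rewrite ?mem_next ?a'Z.
  - rewrite /b'; case: (j.+1 =P n) => [_|ne_n]; first exact: next_neq (ltnW sZ) (a'Z j lt_j).
    rewrite /a'; case: (j =P 0) => [j0|/eqP j0].
      by rewrite j0 in sZ uZ bZ *; rewrite eq_sym next_neq // ltnW.
    (* For an inner cycle, a vertex [a j = b j] would lie in both neighbouring cycles, which are
       disjoint. *)
    apply/eqP=> ab.
    have lt_j1 : j.+1 < n by lia.
    have j_in : 0 < j < n by rewrite lt0n j0.
    have [ba m1] := Zlink j j_in.
    have := m1 (a j); rewrite ba eqxx => /andP[aj1 _].
    have [_ m2] := Zlink j.+1 lt_j1.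
    have := m2 (b j); rewrite eqxx => /andP[_ bj1].
    have := Zdisj j.-1 j.+1 _ lt_j1 _ (a j) aj1; rewrite ab bj1.
    by move=> disj; suff: false by []; apply: disj; lia.
have Zdisj' i j : i.+1 < j < n -> forall x, x \in Z i -> x \notin Z j.
  by move=> /andP[lt_ij lt_jn] x; apply: Zdisj => //; [lia | left].
have lt_n : n.-1 < n by rewrite ltn_predL.
have [r [r_inj _ r_cut]] := chain_prefix_rank Zok' Zdisj' Zlink' lt_n.
rewrite prednK // in r_inj r_cut.
have cover x : [exists j : 'I_n, x \in Z j].
  by have [j [lt_j xj]] := Zcover x; apply/existsP; exists (Ordinal lt_j).
exists r; first by move=> x y; apply: r_inj; apply: cover.
move=> t; apply: leq_trans (r_cut t); apply/subset_leq_card/subsetP=> p.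
rewrite !inE => /andP[/eE[j [lt_j pj]] ->]; rewrite andbT.
by apply/existsP; exists (Ordinal lt_j).
Qed.

(** * Chains as lists of vertex sequences *)

(** The attachment vertices stay implicit, as the points where consecutive members meet. The default
    [[::]] makes the disjointness clause vacuous past the end of the list. *)
Definition linked (V : eqType) (L : seq (seq V)) : Prop :=
  (forall j, j.+1 < size L -> exists a, forall x,
     (x \in nth [::] L j) && (x \in nth [::] L j.+1) = (x == a)) /\
  (forall i j, i.+1 < j -> forall x, x \in nth [::] L i -> x \notin nth [::] L j).

Lemma mem_nth_flatten (V : eqType) (L : seq (seq V)) j x :
  x \in nth [::] L j -> x \in flatten L.
Proof.
move=> xj; apply/flattenP; exists (nth [::] L j) => //; apply: mem_nth.
by case: (ltnP j (size L)) => // /(nth_default [::])-E; rewrite E in xj.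
Qed.

(** No added vertex lies in [L], so the first member meets the others exactly as before. *)
Lemma linked_extend (V : eqType) (S S' : seq V) L :
  linked (S :: L) -> {subset S <= S'} ->
  (forall x, x \in S' -> x \in S \/ x \notin flatten L) -> linked (S' :: L).
Proof.
move=> [meet disj] sub fresh.
have inS x j : x \in S' -> x \in nth [::] L j -> x \in S.
  by move=> /fresh[//|/negP xL /mem_nth_flatten].
split=> [[|j] lt_j|[|i] [|j] // lt_ij x].
- have [c cP] := meet 0 lt_j; exists c => x; rewrite -cP /=.
  apply/andP/andP => -[xS xL]; split=> //; first exact: inS xL.
  exact: sub.
- exact: (meet j.+1).
- move=> /= xS'; apply/negP => xL.
  by have := disj 0 j.+1 lt_ij x (inS _ _ xS' xL); rewrite /= xL.
- exact: (disj i.+1 j.+1).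
Qed.

(** Used to start the next cycle at its attachment vertex [v]. *)
Lemma linked_push (V : eqType) (S : seq V) L v :
  linked (S :: L) -> v \in S -> v \notin flatten L -> linked ([:: v] :: S :: L).
Proof.
move=> [meet disj] vS vL; split=> [[|j] lt_j|[|i] [|[|j]] // lt_ij x].
- by exists v => x; rewrite /= inE; case: eqP => // ->.
- exact: (meet j).
- by rewrite /= inE => /eqP->; apply: contra vL; apply: mem_nth_flatten.
- exact: (disj i j.+1).
Qed.

Lemma linked_chain (V : finType) (S : seq V) (L : seq (seq V)) :
  linked (S :: L) -> all uniq (S :: L) ->
  all (fun Z => 2 < size Z) (S :: L) -> (forall x, x \in flatten (S :: L)) ->
  chain_of_cycles (fun x y => has (fun Z => cycle_edge Z x y) (S :: L)).
Proof.
move: (S :: L) (isT : 0 < size (S :: L)) => {S}L L0 [meet disj] uL sL cov.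
have x0 : V by case: L L0 sL {meet disj uL cov} => // -[//|x Z].
pose Z j := nth [::] L j.
have ZL j : j < size L -> Z j \in L by apply: mem_nth.
(* Filtering recovers the unique meeting vertex; at the two free ends of the chain any vertex
   serves, here the head. *)
pose b j := if j.+1 < size L then head x0 [seq x <- Z j | x \in Z j.+1]
            else head x0 (Z j).
pose a j := if j == 0 then head x0 (Z 0) else b j.-1.
have headZ j : j < size L -> head x0 (Z j) \in Z j.
  by move/ZL/(allP sL); case: (Z j) => // x s _; rewrite inE eqxx.
have bP j : j.+1 < size L -> forall x, (x \in Z j) && (x \in Z j.+1) = (x == b j).
  move=> lt_j; have [c cP] := meet j lt_j.
  suff -> : b j = c by [].
  rewrite /b lt_j; set s := [seq _ <- _ | _].
  have sE x : x \in s = (x == c) by rewrite mem_filter andbC cP.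
  case: s sE => [/(_ c)|y s sE]; first by rewrite eqxx.
  by have := sE y; rewrite inE eqxx => /esym/eqP.
exists (size L), Z, a, b; split=> //; split=> [j lt_j|].
  have jL := ZL _ lt_j; split; [exact: (allP sL) | exact: (allP uL) | | ].
    rewrite /a; case: eqP => [j0|/eqP]; first by rewrite -{1}j0 headZ ?j0.
    rewrite -lt0n => j0; have lt_j' : j.-1.+1 < size L by rewrite prednK.
    by have := bP _ lt_j' (b j.-1); rewrite eqxx prednK // => /andP[].
  case: (ltnP j.+1 (size L)) => [/bP/(_ (b j))|ge_j].
    by rewrite eqxx => /andP[].
  by rewrite /b ltnNge ge_j headZ.
split=> [x|].
  have /flattenP[W WL xW] := cov x; exists (index W L).
  by rewrite index_mem WL /Z nth_index.
split=> [x y|].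
  split=> [/hasP[W WL xy]|[j [lt_j xy]]].
    by exists (index W L); rewrite index_mem WL /Z nth_index.
  by apply/hasP; exists (Z j) => //; apply: ZL.
split=> [i j _ _ [lt_ij|lt_ji] x xi|j /andP[j0 lt_j]].
- exact: disj xi.
- by apply/negP => xj; have := disj _ _ lt_ji x xj; rewrite xi.
have lt_j' : j.-1.+1 < size L by rewrite prednK.
split=> [|x]; first by rewrite /a eqn0Ngt j0.
by have := bP _ lt_j' x; rewrite prednK.
Qed.

(** * Edges of a path and of the cycle that closes it *)

(** Unlike [cycle_edge], this leaves out the closing edge: the path is still open. *)
Definition adjacent (V : eqType) (S : seq V) x y :=
  infix [:: x; y] S || infix [:: y; x] S.

Lemma adjacent_rev (V : eqType) (S : seq V) x y :
  adjacent (rev S) x y = adjacent S x y.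
Proof. by rewrite /adjacent -!(infix_revLR _ S) orbC. Qed.

Lemma adjacent_infix (V : eqType) (S W : seq V) x y :
  infix S W -> adjacent S x y -> adjacent W x y.
Proof.
by move=> SW /orP[] /infix_trans/(_ SW) xy; rewrite /adjacent xy ?orbT.
Qed.

Lemma infix_cycle_edge (V : eqType) (Z : seq V) x y :
  uniq Z -> infix [:: x; y] Z -> cycle_edge Z x y.
Proof.
move=> uZ /infixP[p [s defZ]]; rewrite -(cycle_edge_rot (size p) uZ) defZ rot_size_cat.
by rewrite /cycle_edge /= inE eqxx eqxx.
Qed.

Lemma adjacent_cycle_edge (V : eqType) (Z : seq V) x y :
  uniq Z -> adjacent Z x y -> cycle_edge Z x y.
Proof.
by move=> uZ /orP[] /(infix_cycle_edge uZ) //; rewrite cycle_edge_sym.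
Qed.

(** Rotating the last vertex to the front turns the closing edge into an infix. *)
Lemma cycle_edge_last (V : eqType) (S : seq V) d v :
  uniq (v :: S) -> S != [::] -> cycle_edge (v :: S) (last d S) v.
Proof.
case/lastP: S => // s w uZ _; rewrite last_rcons.
rewrite -(cycle_edge_rot (size (v :: s)) uZ) -rcons_cons -cats1 rot_size_cat.
apply: infix_cycle_edge; first by rewrite uniq_catC cats1.
by rewrite /= !eqxx prefix0s.
Qed.

(** * The sweep: fillers, state and invariant *)

Section Sweep.

Variables (T : finType) (e : rel T) (o : T -> 'I_#|T|).
Hypotheses (e_sym : symmetric e) (e_irr : irreflexive e) (o_inj : injective o).
Hypothesis o_cut : forall i : nat, 1 <= i -> i < #|T| ->
  #|[set p : T * T | e p.1 p.2 && ((o p.1 < i) && (i <= o p.2))]| <= 2.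

(* The right summand holds the filler vertices; at most one of them is
   consumed per swept vertex, and the last two are kept for the final cycle. *)
Let V : Type := (T + 'I_#|T|.+3)%type.
Let d : V := inr ord0.

(** A time stamp: the vertex numbered [i] (from 0) and the filler used along with it both get
    [i.+1], hence are new to a state whose ranks are at most [i]. *)
Definition vrank (x : V) : nat := match x with inl u => (o u).+1 | inr k => k end.

Definition crosses (i : nat) x y := e x y && (o x < i <= o y).

Definition carries (h : V) (A : option T) x y := (h == inl x) && (A == Some y).

(** The length condition spares [S], which is still growing. *)
Record partial_chain (i : nat) (S : seq V) (Zs : seq (seq V)) : Prop :=
  PartialChain {
    pc_linked : linked (S :: Zs);
    pc_uniq : all uniq (S :: Zs);
    pc_size : all (fun Z => 2 < size Z) Zs;
    pc_rank : forall x, x \in flatten (S :: Zs) -> vrank x <= i }.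

(* State after placing the first [i] vertices: the closed cycles [Zs], latest
   first, and the path [S] of the cycle under construction. Every edge across
   the cut leaves from an end of [S]; [A] and [B] are the endpoints still to
   come of the edges at the head and at the last vertex. *)
Record sweep (i : nat) (S : seq V) (Zs : seq (seq V)) (A B : option T) : Prop :=
  Sweep {
    sw_ne : S != [::];
    sw_pc : partial_chain i S Zs;
    sw_edge : forall x y, e x y -> o x < o y < i ->
      adjacent S (inl x : V) (inl y) || has (fun Z => cycle_edge Z (inl x : V) (inl y)) Zs;
    sw_cross : forall x y, crosses i x y ->
      carries (head d S) A x y || carries (last d S) B x y;
    sw_head : forall y, A = Some y -> exists2 x, head d S = inl x & crosses i x y;
    sw_last : forall y, B = Some y -> exists2 x, last d S = inl x & crosses i x y;
    sw_dist : head d S = last d S -> A = B -> A = None }.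

Lemma head_rev (S : seq V) : head d (rev S) = last d S.
Proof. by case/lastP: S => // s x; rewrite rev_rcons last_rcons. Qed.

Lemma last_rev (S : seq V) : last d (rev S) = head d S.
Proof. by rewrite -head_rev revK. Qed.

Lemma partial_chain_extend i S S' Zs :
  partial_chain i S Zs -> uniq S' -> {subset S <= S'} ->
  (forall x, x \in S' -> x \in S \/ vrank x = i.+1) ->
  partial_chain i.+1 S' Zs.
Proof.
case=> lk /= /andP[_ u] sz rk uS' sub fresh; split=> //=.
- apply: (linked_extend lk sub) => x /fresh[xS|rx]; first by left.
  right; apply/negP => xZ; have := rk x; rewrite mem_cat xZ orbT rx => /(_ isT).
  by rewrite ltnn.
- by rewrite uS'.
- move=> x; rewrite mem_cat => /orP[/fresh[xS|->//]|xZ]; apply: leqW; apply: rk.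
    by rewrite mem_cat xS.
  by rewrite mem_cat xZ orbT.
Qed.

Lemma partial_chain_rev i S Zs : partial_chain i S Zs -> partial_chain i (rev S) Zs.
Proof.
case=> lk /= /andP[uS u] sz rk; split=> //=.
- apply: (linked_extend lk) => x; rewrite mem_rev //; by left.
- by rewrite rev_uniq uS.
- by move=> x; rewrite mem_cat mem_rev -mem_cat; apply: rk.
Qed.

(** The two ends play symmetric roles; this halves the case analysis of a step. *)
Lemma sweep_rev i S Zs A B : sweep i S Zs A B -> sweep i (rev S) Zs B A.
Proof.
case=> ne pc ed cr hd la di; split; rewrite ?head_rev ?last_rev //.
- by rewrite -size_eq0 size_rev size_eq0.
- exact: partial_chain_rev.
- by move=> x y xy lt_xy; rewrite adjacent_rev; apply: ed.
- by move=> x y /cr; rewrite orbC.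
- by move=> eq_hl eq_AB; rewrite eq_AB; apply: di.
Qed.

(** Any member of [s] forces [0 < i < #|T|], so the cut bound applies. *)
Lemma crosses_size i (s : seq (T * T)) :
  uniq s -> {in s, forall p, crosses i p.1 p.2} -> size s <= 2.
Proof.
move=> us cr; case: s us cr => // p s us cr.
have /andP[_ /andP[lt_i le_i]] := cr p (mem_head _ _).
have i0 : 0 < i by apply: leq_ltn_trans lt_i.
have := o_cut i0 (leq_ltn_trans le_i (ltn_ord _)); apply: leq_trans.
rewrite cardE; apply: uniq_leq_size => // q /cr; rewrite mem_enum inE.
by rewrite /crosses.
Qed.

(** * Placing one vertex [v] *)

Section Step.

Variables (i : nat) (v : T) (S : seq V) (Zs : seq (seq V)) (A B : option T).
Hypotheses (ov : o v = i :> nat) (sw : sweep i S Zs A B).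

Let later := [seq y <- enum T | e v y && (i < o y)].

(** Only [v] has number [i], so only edges at [v] enter or leave the cut. *)
Lemma crossesS x y : crosses i.+1 x y =
  crosses i x y && (y != v) || (x == v) && (y \in later).
Proof.
rewrite /crosses mem_filter mem_enum andbT.
have -> : (y != v) = (o y != i :> nat).
  by rewrite -ov; congr negb; apply/eqP/eqP => [->//|/val_inj/o_inj].
have [->|ne_x] := eqVneq x v.
  by rewrite ov; case: (e v y); lia.
have ne : o x != i :> nat.
  by rewrite -ov; apply: contra ne_x => /eqP/val_inj/o_inj->.
case: (e x y) => //=; rewrite orbF.
by move: ne; move: (o x : nat) (o y : nat) => p q; lia.
Qed.

(** Edges opened by [v] and old edges that survive it share the next cut; they are distinct, as old
    ones start before [v]. *)
Lemma later_size (s : seq (T * T)) : uniq s ->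
  {in s, forall p, crosses i p.1 p.2 && (p.2 != v)} -> size later + size s <= 2.
Proof.
move=> us cr; rewrite -(size_map (pair v)) -size_cat.
apply: (@crosses_size i.+1).
  rewrite cat_uniq us map_inj_uniq => [|y z []//].
  rewrite filter_uniq ?enum_uniq //= andbT; apply/hasPn => p /cr /andP[].
  move=> /andP[_ /andP[lt_p _]] _; apply/mapP => -[y _ Ep].
  by move: lt_p; rewrite Ep /= ov ltnn.
move=> p; rewrite mem_cat crossesS => /orP[/mapP[y yl ->]|/cr->//].
by rewrite /= eqxx yl orbT.
Qed.

Lemma new_notin x : vrank x = i.+1 -> (x \notin S) && (x \notin flatten Zs).
Proof.
move=> rx; rewrite -negb_or -mem_cat; apply/negP => /(pc_rank (sw_pc sw)).
by rewrite rx ltnn.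
Qed.

Lemma vrankv : vrank (inl v) = i.+1. Proof. by rewrite /= ov. Qed.

Lemma sweep_edgeS x y : e x y -> o x < o y < i.+1 ->
  [|| adjacent S (inl x : V) (inl y),
      has (fun Z => cycle_edge Z (inl x : V) (inl y)) Zs
    | (y == v) && crosses i x v].
Proof.
move=> xy /andP[lt_xy]; rewrite ltnS leq_eqVlt => /orP[/eqP oy|lt_y].
  have yv : y = v by apply/o_inj/val_inj; rewrite /= oy.
  by rewrite yv eqxx /crosses ov leqnn -yv xy -oy lt_xy !orbT.
by have := sw_edge sw xy; rewrite lt_xy lt_y => /(_ isT); case/orP=> ->; rewrite ?orbT.
Qed.

(** All pending edges end at [v] and become edges of [W], so [W] is finished and the next cycle
    starts as the path consisting of [v] alone. *)
Lemma sweep_close W : uniq W -> infix S W -> inl v \in W -> 2 < size W ->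
  (forall x, x \in W -> x \in S \/ vrank x = i.+1) ->
  (forall x, crosses i x v -> cycle_edge W (inl x : V) (inl v)) ->
  (forall x y, crosses i x y -> y = v) ->
  exists A' B', sweep i.+1 [:: inl v] (W :: Zs) A' B'.
Proof.
move=> uW SW vW sW fresh edge_v only_v.
have pcW : partial_chain i.+1 W Zs.
  exact: partial_chain_extend (sw_pc sw) uW (mem_infix SW) fresh.
have pcv : partial_chain i.+1 [:: inl v] (W :: Zs).
  case: (pcW) => lk uWs sz rk; split=> //=.
  - by apply: linked_push => //; have /andP[] := new_notin vrankv.
  - by rewrite sW.
  - by move=> x; rewrite inE => /predU1P[->|/rk//]; rewrite vrankv.
have ls : size later <= 2 by have := later_size (s := [::]) isT; rewrite addn0; apply.
have ed x y : e x y -> o x < o y < i.+1 ->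
    adjacent [:: inl v] (inl x : V) (inl y) ||
    has (fun Z => cycle_edge Z (inl x : V) (inl y)) (W :: Zs).
  move=> xy lt_xy; case/or3P: (sweep_edgeS xy lt_xy) => /= [adj|->|/andP[/eqP-> cr]].
  - by rewrite (adjacent_cycle_edge uW (adjacent_infix SW adj)) orbT.
  - by rewrite !orbT.
  - by rewrite edge_v ?orbT.
have crS x y : crosses i.+1 x y = (x == v) && (y \in later).
  by rewrite crossesS; case: (boolP (crosses i x y)) => // /only_v->; rewrite eqxx.
have ul : uniq later by rewrite filter_uniq ?enum_uniq.
(* Both ends of the new path are [v]; its at most two outgoing edges are shared out between them. *)
exists (ohead later), (ohead (behead later)); split=> //=.
- move=> x y; rewrite crS /carries => /andP[/eqP-> yl]; rewrite !eqxx /=.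
  case: later ls yl => [|y1 [|y2 []]] //= _; rewrite !inE.
    by move/eqP->; rewrite eqxx.
  by case/orP=> /eqP->; rewrite eqxx ?orbT.
- move=> y Ey; exists v => //; rewrite crS eqxx /=.
  by case: later Ey => //= z s [->]; rewrite mem_head.
- move=> y Ey; exists v => //; rewrite crS eqxx /=.
  by case: later Ey => [|z [|z' s]] //= [->]; rewrite !inE eqxx orbT.
- move=> _; case: later ul => [|z [|z' s]] //= /andP[+ _] [zz'].
  by rewrite zz' inE eqxx.
Qed.

(** The edge pending at the last vertex survives, so [v] opens at most one edge and can carry it as
    the new head. If nothing was pending at the old head, the path merely gains an edge absent from
    [e]. *)
Lemma sweep_extend y : A = None \/ A = Some v -> B = Some y -> y != v ->
  exists A', sweep i.+1 (inl v :: S) Zs A' B.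
Proof.
move=> AE By ne_yv.
have [w lw cr_w] := sw_last sw By.
have ls : size later <= 1.
  have := later_size (s := [:: (w, y)]) isT; rewrite addn1 ltnS; apply.
  by move=> p; rewrite inE => /eqP-> /=; rewrite cr_w.
have /andP[vS _] := new_notin vrankv.
have lastS : last d (inl v :: S) = last d S by case: (S) (sw_ne sw).
have hS : S = head d S :: behead S by case: (S) (sw_ne sw).
exists (ohead later); split=> //.
- apply: partial_chain_extend (sw_pc sw) _ _ _.
  + by have /andP[uS _] := pc_uniq (sw_pc sw); rewrite /= vS.
  + by move=> x xS; rewrite inE xS orbT.
  + by move=> x; rewrite inE => /predU1P[->|]; [right; rewrite vrankv | left].
- move=> x z xz lt_xz; case/or3P: (sweep_edgeS xz lt_xz) => [adj|->|/andP[/eqP-> cr]].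
  + by rewrite (adjacent_infix (infix_cons _ _) adj).
  + by rewrite orbT.
  + case/orP: (sw_cross sw cr) => /andP[/eqP hx /eqP Ez].
      by rewrite hS hx /adjacent /= !eqxx prefix0s orbT.
    by move: ne_yv; rewrite By in Ez; case: Ez => ->; rewrite eqxx.
- move=> x z; rewrite crossesS lastS => /orP[/andP[cr nzv]|/andP[/eqP-> zl]].
    case/orP: (sw_cross sw cr) => [/andP[_ /eqP Az]|->]; last by rewrite orbT.
    by move: nzv; case: AE => AE; rewrite AE in Az => //; case: Az => ->; rewrite eqxx.
  rewrite /carries /= eqxx /=.
  by case: later ls zl => [|z1 []] //= _; rewrite inE => /eqP->; rewrite eqxx.
- move=> z Ez; exists v => //; rewrite crossesS eqxx /=.
  by case: later Ez => //= z' s [->]; rewrite mem_head orbT.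
- move=> z Ez; have [x hx cr] := sw_last sw Ez; exists x; rewrite ?lastS //.
  by rewrite crossesS cr; move: Ez; rewrite By => -[<-]; rewrite ne_yv.
- rewrite lastS lw => -[vw]; move: cr_w => /andP[_ /andP[]].
  by rewrite -vw ov ltnn.
Qed.

(* The two pending edges already saturate the next cut, so [v] is isolated. *)
Lemma sweep_skip y z : A = Some y -> y != v -> B = Some z -> z != v ->
  sweep i.+1 S Zs A B.
Proof.
move=> Ay ne_y Bz ne_z.
have [x hx cr_x] := sw_head sw Ay; have [w lw cr_w] := sw_last sw Bz.
have ls : later = [::].
  apply/nilP; rewrite /nilp -leqn0.
  have := later_size (s := [:: (x, y); (w, z)]); rewrite addn2 !ltnS; apply.
    (* The two pending edges differ: by [sw_dist], coinciding ends cannot carry the same edge. *)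
    rewrite /= inE andbT; apply/eqP => -[xw yz].
    have := sw_dist sw; rewrite hx lw xw Ay Bz yz => /(_ erefl erefl).
    by [].
  by move=> p; rewrite !inE => /orP[]/eqP-> /=; rewrite ?cr_x ?cr_w.
have crS a b : crosses i a b -> b != v -> crosses i.+1 a b.
  by rewrite crossesS => -> ->.
split.
- exact: (sw_ne sw).
- have /andP[uS _] := pc_uniq (sw_pc sw).
  by apply: partial_chain_extend (sw_pc sw) uS _ _ => // a aS; left.
- move=> a b ab lt_ab.
  case/or3P: (sweep_edgeS ab lt_ab) => [->//|->|/andP[_ cr]]; first by rewrite orbT.
  case/orP: (sw_cross sw cr) => /andP[_ /eqP].
    by rewrite Ay => -[E]; rewrite E eqxx in ne_y.
  by rewrite Bz => -[E]; rewrite E eqxx in ne_z.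
- move=> a b; rewrite crossesS ls andbF orbF => /andP[cr _].
  exact: (sw_cross sw).
- move=> b Eb; exists x => //; apply: crS; first by move: Eb; rewrite Ay => -[<-].
  by move: Eb; rewrite Ay => -[<-].
- move=> b Eb; exists w => //; apply: crS; first by move: Eb; rewrite Bz => -[<-].
  by move: Eb; rewrite Bz => -[<-].
- exact: (sw_dist sw).
Qed.

(** A new filler joins the free last vertex to [v], giving a cycle of length at least three even if
    [S] is a single vertex. *)
Lemma sweep_close_filler : B = None -> A = None \/ A = Some v ->
  exists S' Zs' A' B', sweep i.+1 S' Zs' A' B'.
Proof.
move=> BN AE.
have lt_i : i < #|T| by rewrite -ov ltn_ord.
pose f : V := inr (inord i.+1).
have rf : vrank f = i.+1 by rewrite /= inordK // !ltnS; apply/leqW/ltnW.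
have fresh x : vrank x = i.+1 -> x \notin S.
  by case/new_notin/andP.
have hS : S = head d S :: behead S by case: (S) (sw_ne sw).
have /andP[uS _] := pc_uniq (sw_pc sw).
have uW : uniq (inl v :: rcons S f).
  by rewrite /= mem_rcons inE rcons_uniq uS !fresh ?vrankv.
have [A' [B' sw']] : exists A' B', sweep i.+1 [:: inl v] ((inl v :: rcons S f) :: Zs) A' B'.
  apply: sweep_close => //.
  - exact: infix_trans (infix_rcons _ _) (infix_cons _ _).
  - exact: mem_head.
  - by rewrite hS /= size_rcons.
  - move=> x; rewrite inE mem_rcons inE => /or3P[/eqP->|/eqP->|]; try by right.
      by right; rewrite vrankv.
    by left.
  - move=> x cr; case/orP: (sw_cross sw cr) => /andP[/eqP hx /eqP Ex]; last first.
      by rewrite BN in Ex.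
    rewrite cycle_edge_sym; apply: infix_cycle_edge => //.
    by rewrite hS hx /= !eqxx prefix0s.
  - move=> x y cr; case/orP: (sw_cross sw cr) => /andP[_ /eqP Ex]; last by rewrite BN in Ex.
    by case: AE => AE; rewrite AE in Ex => //; case: Ex.
by exists [:: inl v], ((inl v :: rcons S f) :: Zs), A', B'.
Qed.

(** Here [v] is a neighbour of both ends and closes the path by itself. *)
Lemma sweep_close_both : A = Some v -> B = Some v ->
  exists S' Zs' A' B', sweep i.+1 S' Zs' A' B'.
Proof.
move=> Av Bv.
have /andP[vS _] := new_notin vrankv.
have hS : S = head d S :: behead S by case: (S) (sw_ne sw).
have /andP[uS _] := pc_uniq (sw_pc sw).
have uW : uniq (inl v :: S) by rewrite /= vS.
have [A' [B' sw']] : exists A' B', sweep i.+1 [:: inl v] ((inl v :: S) :: Zs) A' B'.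
  apply: sweep_close => //.
  - exact: infix_cons.
  - exact: mem_head.
  (* A one-vertex path would carry the same edge to [v] at both ends, against [sw_dist]; so the
     cycle has at least three vertices. *)
  - have := sw_dist sw; rewrite Av Bv.
    case: (S) (sw_ne sw) => [|x [|y s]] //= _ /(_ erefl erefl) //.
  - by move=> x; rewrite inE => /predU1P[->|]; [right; rewrite vrankv | left].
  - move=> x cr; case/orP: (sw_cross sw cr) => /andP[/eqP hx _]; last first.
      by rewrite -hx cycle_edge_last // (sw_ne sw).
    rewrite cycle_edge_sym; apply: infix_cycle_edge => //.
    by rewrite hS hx /= !eqxx prefix0s.
  - move=> x y cr; case/orP: (sw_cross sw cr) => /andP[_].
      by rewrite Av => /eqP[].
    by rewrite Bv => /eqP[].
by exists [:: inl v], ((inl v :: S) :: Zs), A', B'.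
Qed.

End Step.

(** * Running the sweep and completing the chain *)

(** If both ends have edges pending beyond [v], skip [v]. Otherwise, up to reversal, the head is
    free or waits for [v], and the other end decides between extending and closing. *)
Lemma sweep_step i S Zs A B : i < #|T| -> sweep i S Zs A B ->
  exists S' Zs' A' B', sweep i.+1 S' Zs' A' B'.
Proof.
move=> lt_i sw.
have [g _ og] := inj_card_bij o_inj (eq_leq (card_ord _)).
pose v := g (Ordinal lt_i).
have ov : o v = i :> nat by rewrite og.
have step S0 A0 B0 : sweep i S0 Zs A0 B0 -> A0 = None \/ A0 = Some v ->
    exists S' Zs' A' B', sweep i.+1 S' Zs' A' B'.
  move=> sw0 AE; case EB: B0 => [y|]; last by apply: sweep_close_filler ov sw0 EB AE.
  case: (eqVneq y v) => [yv|ne_y]; last first.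
    by have [A' sw'] := sweep_extend ov sw0 AE EB ne_y; exists (inl v :: S0), Zs, A', B0.
  case: AE => AE; last by apply: sweep_close_both ov sw0 AE _; rewrite EB yv.
  by apply: sweep_close_filler ov (sweep_rev sw0) AE _; right; rewrite EB yv.
have isv (C : option T) : (C = None \/ C = Some v) \/ exists2 y, C = Some y & y != v.
  case: C => [y|]; last by left; left.
  by case: (eqVneq y v) => [->|ne]; [left; right | right; exists y].
case: (isv A) => [|[y Ay ne_y]]; first exact: step sw.
case: (isv B) => [|[z Bz ne_z]]; first exact: step (sweep_rev sw).
by exists S, Zs, A, B; apply: (sweep_skip ov sw Ay ne_y Bz ne_z).
Qed.

Lemma sweep_exists i : i <= #|T| -> exists S Zs A B, sweep i S Zs A B.
Proof.
elim: i => [_|i IHi lt_i]; last first.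
  by have [S [Zs [A [B /(sweep_step lt_i)]]]] := IHi (ltnW lt_i).
(* The filler of rank 0 is the initial path. *)
exists [:: d], [::], None, None; split=> //.
- split=> //; last by move=> x; rewrite inE => /eqP->.
  by split=> // i [|[|j]].
- by move=> x y _ /andP[].
- by move=> x y /andP[_ /andP[]].
Qed.

Lemma sweep_embed : exists (T' : finType) (e' : rel T'),
  chain_of_cycles e' /\
  exists f : T -> T', injective f /\ forall x y : T, e x y -> e' (f x) (f y).
Proof.
have [S [Zs [A [B sw]]]] := sweep_exists (leqnn _).
(* Everything still unplaced, skipped vertices and spare fillers alike, is appended to the last
   path, so that the chain covers [V]. *)
pose M : seq V := [seq x <- enum {: V} | x \notin flatten (S :: Zs)].
have [lk /= /andP[uS uZs] sz rk] := sw_pc sw.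
have MP x : x \in M = (x \notin flatten (S :: Zs)) by rewrite mem_filter mem_enum andbT.
have uW : uniq (S ++ M).
  rewrite cat_uniq uS filter_uniq ?enum_uniq // andbT /=.
  by apply/hasPn => x; rewrite MP mem_cat negb_or => /andP[].
have sW : 2 < size (S ++ M).
  have S0 : 0 < size S by rewrite lt0n size_eq0 (sw_ne sw).
  rewrite size_cat; suff: 1 < size M by exact: (leq_add S0).
  pose f k : V := inr (inord k).
  have rf k : k < #|T|.+3 -> vrank (f k) = k by move=> lt_k; rewrite /= inordK.
  (* These two fillers rank above [#|T|], hence were never placed; they bring the last cycle to
     length three. *)
  apply: (@uniq_leq_size _ [:: f #|T|.+1; f #|T|.+2]).
    rewrite /= inE andbT; apply/eqP => /(congr1 vrank); rewrite !rf // => /eqP.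
    by rewrite eqn_leq ltnn andbF.
  move=> x xf; rewrite MP; apply/negP => /rk.
  by move: xf; rewrite !inE => /orP[]/eqP->; rewrite rf // leqNgt ltnS ?leqnn ?leqnSn.
pose L := (S ++ M) :: Zs.
exists (V : finType), (fun x y => has (fun Z => cycle_edge Z x y) L); split.
  apply: linked_chain => /=; rewrite ?uW ?sW //.
    apply: (linked_extend lk) => x; rewrite mem_cat; first by move->.
    case/orP=> [|]; first by left.
    by rewrite MP mem_cat negb_or => /andP[]; right.
  move=> x; rewrite !mem_cat MP /= mem_cat.
  by case: (x \in S); case: (x \in flatten Zs).
exists inl; split=> [x y []//|x y].
wlog lt_xy : x y / o x < o y => [sym_xy|xy].
  move=> xy; case: (ltngtP (o x) (o y)) => [lt_xy|lt_yx|eq_xy].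
  - exact: sym_xy.
  - rewrite e_sym in xy; have /hasP[Z ZL yx] := sym_xy _ _ lt_yx xy.
    by apply/hasP; exists Z; rewrite // cycle_edge_sym.
  - by move: xy; rewrite (o_inj (val_inj eq_xy)) e_irr.
have := sw_edge sw xy; rewrite lt_xy ltn_ord => /(_ isT)/orP[adj|Zxy].
  by rewrite /L /= adjacent_cycle_edge // (adjacent_infix _ adj) // prefix_infix.
by rewrite /L /= Zxy orbT.
Qed.

End Sweep.

Theorem mainTheorem1 (T : finType) (e : rel T)
  (e_sym : symmetric e) (e_irr : irreflexive e) :
  cutwidth_le2 e <->
  exists (T' : finType) (e' : rel T'),
    chain_of_cycles e' /\
    exists f : T -> T', injective f /\ forall x y : T, e x y -> e' (f x) (f y).
Proof.
split=> [[o [o_inj o_cut]]|[T' [e' [ch [f [f_inj f_hom]]]]]].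
  exact: sweep_embed e_sym e_irr o_inj o_cut.
have [r r_inj r_cut] := chain_rank ch.
exact: cutwidth_le2_embed f_inj f_hom r_inj r_cut.
Qed.
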